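(* Let $A$ and $B$ be two (finite) ordered posets viewed as complete $RN$ graphs. Then there exists a sequence of (finite) $RN$ graphs $C_2, C_3, \dots$ such that for every $\ell\ge 2$: (1) $C_\ell\to (B)^A_2$; (2) $C_\ell$ is an $\ell$-$RN$ graph; (3) there is a homomorphism $h_\ell\colon C_{\ell+1}\to C_\ell$. In particular, $h^*_\ell = h_2\circ h_3\circ\dots\circ h_{\ell-1}$ is a homomorphism from $C_\ell$ to $C_2$ (the identity map if $\ell=2$).
   Context: All objects are finite. An ordered poset $(X,R,\leq)$ is a finite partially ordered set $(X,R)$, with $R$ taken to be the strict (irreflexive, transitive) order relation, together with a linear order $\leq$ on $X$ extending it, i.e. $R\subseteq\ \leq$. An $RN$ graph $A=(X,R,N,\leq)$ consists of a finite set $X$, a linear order $\leq$ on $X$ and two acyclic (in particular loopless) relations $R,N\subseteq X\times X$ which are disjoint ($R\cap N=\emptyset$) and compatible with $\leq$ (both $R\subseteq\ \leq$ and $N\subseteq\ \leq$). Write $X(A)=X$, $R(A)=R$, $N(A)=N$, $\leq_A\,=\,\leq$, and $<_A\,=\{(x,y): x\leq_A y,\ x\neq y\}$. The $RN$ graph $A$ is complete if $<_A\,=R(A)\cup N(A)$. An ordered poset $(X,R,\leq)$ is viewed as the complete $RN$ graph $(X,R,N,\leq)$ with $N=\,<\setminus R$. An embedding of an $RN$ graph $A$ into an $RN$ graph $B$ is an injective map $f\colon X(A)\to X(B)$ such that for all $x,y\in X(A)$: $(x,y)\in R(A)\iff (f(x),f(y))\in R(B)$; $(x,y)\in N(A)\iff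 (f(x),f(y))\in N(B)$; and $x\leq_A y\iff f(x)\leq_B f(y)$. $\binom{B}{A}$ denotes the set of all copies of $A$ in $B$, i.e. all induced sub-$RN$-graphs of $B$ that are images of embeddings of $A$ into $B$. A homomorphism from an $RN$ graph $C$ to an $RN$ graph $D$ is a (not necessarily injective) map $f\colon X(C)\to X(D)$ preserving all relations: $(x,y)\in R(C)\Rightarrow (f(x),f(y))\in R(D)$; $(x,y)\in N(C)\Rightarrow (f(x),f(y))\in N(D)$; and $x\leq_C y\Rightarrow f(x)\leq_D f(y)$. $C\to (B)^A_2$ means: for every colouring of $\binom{C}{A}$ with 2 colours there is $\tilde B\in\binom{C}{B}$ such that all elements of $\binom{\tilde B}{A}$ have the same colour. A bad quasicycle of length $j\geq 2$ in an $RN$ graph $(X,R,N,\leq)$ consists of $j$ vertices $x=x_1,x_2,\dots,x_j=y$ with $(x_i,x_{i+1})\in R$ for $i=1,\dots,j-1$ and $(x,y)\in N$. For an integer $\ell\geq 2$, an $RN$ graph is an $\ell$-$RN$ graph if it contains no bad quasicycle of length $j$ for any $j\in\{2,\dots,\ell\}$. *)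

(* Defs.v *)
From mathcomp Require Import all_boot.

Set Implicit Arguments.
Unset Strict Implicit.
Unset Printing Implicit Defensive.

Definition linear_order (T : Type) (le : rel T) : Prop :=
  [/\ reflexive le, antisymmetric le, transitive le & total le].

(* In particular irreflexive: [cycle r [:: x]] is [r x x]. *)
Definition acyclic (T : Type) (r : rel T) : Prop :=
  forall s : seq T, cycle r s -> s = [::].

Record RNgraph := MkRNgraph {
  vert :> finType;
  relR : rel vert;
  relN : rel vert;
  ord : rel vert;
  ord_linear : linear_order ord;
  relR_acyclic : acyclic relR;
  relN_acyclic : acyclic relN;
  relRN_disjoint : forall x y, ~~ (relR x y && relN x y);
  relR_ord : subrel relR ord;
  relN_ord : subrel relN ord
}.

Definition sord (G : RNgraph) : rel G := fun x y => ord x y && (x != y).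

Definition complete (G : RNgraph) : Prop :=
  forall x y : G, sord x y = relR x y || relN x y.

Record oposet := MkOposet {
  pvert :> finType;
  plt : rel pvert;
  pord : rel pvert;
  plt_irr : irreflexive plt;
  plt_trans : transitive plt;
  pord_linear : linear_order pord;
  plt_pord : subrel plt pord
}.

Lemma irr_subrel_acyclic (T : eqType) (r le : rel T) :
  linear_order le -> irreflexive r -> subrel r le -> acyclic r.
Proof.
move=> [_ le_anti le_tr _] r_irr r_le [//|x p] /= rxp.
suff lt_path : forall y q, path r y q -> q != [::] ->
    le y (last y q) && (y != last y q).
  have := lt_path x (rcons p x) rxp; rewrite last_rcons eqxx andbF.
  by apply: contraPeq => _; apply/implyP; case: (p).
move=> y q; elim: q y => [//|z q IHq] y /= /andP[ryz rzq] _.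
have le_yz := r_le _ _ ryz.
have ne_yz : y != z by apply: contraTneq ryz => ->; rewrite r_irr.
case: q IHq rzq => [|t q] IHq rzq; first by rewrite /= le_yz.
have /andP[le_zl ne_zl] := IHq z rzq isT.
rewrite (le_tr z) //=; apply: contraNneq ne_yz => eq_yl; apply/eqP.
by apply: le_anti; rewrite le_yz eq_yl.
Qed.

Section PosetGraph.

Variable P : oposet.

Definition pnon : rel P := fun x y => [&& pord x y, x != y & ~~ plt x y].

Fact plt_acyclic : acyclic (@plt P).
Proof.
exact: irr_subrel_acyclic (pord_linear P) (@plt_irr P) (@plt_pord P).
Qed.

Fact pnon_ord : subrel pnon (@pord P).
Proof. by move=> x y /and3P[]. Qed.

Fact pnon_acyclic : acyclic pnon.
Proof.
apply: irr_subrel_acyclic (pord_linear P) _ pnon_ord => x.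
by rewrite /pnon eqxx andbF.
Qed.

Fact plt_pnon_disjoint (x y : P) : ~~ (plt x y && pnon x y).
Proof. by rewrite /pnon; case: (plt x y); rewrite ?andbF. Qed.

Definition graph_of_poset : RNgraph :=
  MkRNgraph (pord_linear P) plt_acyclic pnon_acyclic plt_pnon_disjoint
            (@plt_pord P) pnon_ord.

Lemma graph_of_poset_complete : complete graph_of_poset.
Proof.
move=> x y; rewrite /sord /= /pnon; have [lt_xy|_] := boolP (plt x y).
  rewrite (plt_pord lt_xy); apply: contraTneq lt_xy => ->.
  by rewrite plt_irr.
by rewrite andbT.
Qed.

End PosetGraph.

Coercion graph_of_poset : oposet >-> RNgraph.

Section Induced.

Variables (G : RNgraph) (S : {set G}).

Let V : finType := {x : G | x \in S}.
Definition indR : rel V := fun x y => relR (val x) (val y).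
Definition indN : rel V := fun x y => relN (val x) (val y).
Definition indord : rel V := fun x y => ord (val x) (val y).

Fact indord_linear : linear_order indord.
Proof.
have [rfl anti tr tot] := ord_linear G; split=> [x|x y le|y x z|x y].
- exact: rfl.
- exact/val_inj/anti.
- exact: tr.
- exact: tot.
Qed.

Fact indR_acyclic : acyclic indR.
Proof.
move=> s cs; have /relR_acyclic : cycle (@relR G) (map val s).
  by rewrite cycle_map.
by case: s {cs}.
Qed.

Fact indN_acyclic : acyclic indN.
Proof.
move=> s cs; have /relN_acyclic : cycle (@relN G) (map val s).
  by rewrite cycle_map.
by case: s {cs}.
Qed.

Fact indRN_disjoint (x y : V) : ~~ (indR x y && indN x y).
Proof. exact: relRN_disjoint. Qed.

Fact indR_ord : subrel indR indord.
Proof. by move=> x y; apply: relR_ord. Qed.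

Fact indN_ord : subrel indN indord.
Proof. by move=> x y; apply: relN_ord. Qed.

Definition induced : RNgraph :=
  MkRNgraph indord_linear indR_acyclic indN_acyclic indRN_disjoint
            indR_ord indN_ord.

End Induced.

Definition embedding (A B : RNgraph) (f : A -> B) : Prop :=
  injective f /\
  forall x y : A, [/\ relR x y = relR (f x) (f y),
                      relN x y = relN (f x) (f y)
                    & ord x y = ord (f x) (f y)].

Definition homomorphism (C D : RNgraph) (f : C -> D) : Prop :=
  forall x y : C, [/\ relR x y -> relR (f x) (f y),
                      relN x y -> relN (f x) (f y)
                    & ord x y -> ord (f x) (f y)].

(* An induced sub-RN-graph is identified with its vertex set. *)
Definition is_copy (A B : RNgraph) (S : {set B}) : Prop :=
  exists2 f : A -> B, embedding f & S = [set f x | x : A].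

(* C -> (B)^A_r.  A colouring of the copies of A in C is given as a map on all
   vertex sets, of which only the values at copies matter; a copy T of A in
   the induced subgraph on S has vertex set [val @: T] in C. *)
Definition arrows (r : nat) (C B A : RNgraph) : Prop :=
  forall chi : {set C} -> 'I_r,
  exists2 S : {set C}, is_copy B S &
    forall T1 T2 : {set induced S}, is_copy A T1 -> is_copy A T2 ->
      chi [set val x | x in T1] = chi [set val x | x in T2].

(* Distinctness of the vertices is automatic, since R is acyclic. *)
Definition bad_quasicycle (G : RNgraph) (j : nat) (s : seq G) : Prop :=
  size s = j /\
  if s is x :: p then path (@relR G) x p /\ relN x (last x p) else False.

Definition l_RN (l : nat) (G : RNgraph) : Prop :=
  forall j, 2 <= j <= l -> forall s : seq G, ~ bad_quasicycle j s.

(* [hstar h k] is h*_l for l = k.+2, i.e. h_2 \o h_3 \o ... \o h_(l-1). *)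
Fixpoint hstar (C : nat -> RNgraph) (h : forall l, 2 <= l -> C l.+1 -> C l)
    (k : nat) : C k.+2 -> C 2 :=
  match k return C k.+2 -> C 2 with
  | 0 => id
  | m.+1 => hstar h (k := m) \o h m.+2 isT
  end.

(* Main.v *)
Require Import Defs.
From mathcomp Require Import all_boot zify.

(** The construction works with finite vertex sets carrying two relations, R
(index true) and N (index false), and with maps preserving both.  Vertex
orders are kept apart: if a homomorphism [q : W -> V] goes to a linearly
ordered graph whose edges increase, then any linear order of [W] refining the
preorder pulled back along [q] makes [q] monotone and the edges of [W]
increasing.  Moreover every pair of distinct vertices of the posets [A] and
[B] is joined by an edge, so a homomorphism from one of them to a linearly
ordered graph with increasing edges and disjoint R and N is automatically an
embedding ([hom_embedding]), and the Ramsey property can be stated with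
homomorphisms only ([hom_arrows]).

All graphs [C l] come from one step ([partite_construction]), the partite
construction: from a graph [V] with the Ramsey property and without bad
quasicycles on at most [l] vertices it makes a graph [W] with the Ramsey
property, a homomorphism to [V], and no bad quasicycles on at most [l + 1]
vertices.  Begin with disjoint copies of [B], one over each homomorphism
[B -> V].  Then treat one by one the homomorphisms [f : A -> V]: by the
Hales-Jewett theorem the current graph [P] over [V] can be replaced by a union
of copies of [P], glued only over the image of [f], such that for any colouring
one of the copies of [P] has all its lifts of [f] in one colour
([amalgam_ramsey]).  At the end, the colour of a lift depends only on [f] inside
some copy of the initial graph, and the Ramsey property of [V] chooses the copy
of [B].

Bad quasicycles become longer for the following reason ([amalgam_qcfree]).
One on at most [l] vertices would project to [V], so consider one on [l + 1]
vertices.  Any two distinct vertices of [V] in the image of [f] are joined by an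
edge, and this edge would split the projected cycle, unless its ends are
neighbours in it, leaving a shorter bad quasicycle of [V] ([no_chord]).  Hence at
most two vertices of the cycle, and neighbours, lie over the image of [f], where
the copies of [P] are glued, and the cycle cannot leave a single copy of [P]
([linked_cycle]), which is an induced subgraph ([copy_reflect]).  The exception
is a triangle entirely over the image of [f], which would give one in the poset
[A].

The sequence starts at [l = 1], where the condition only says that N has no
loops: the chain in which both R and N are the strict order.  Its Ramsey property
is the finite Ramsey theorem ([ramsey]). *)

Set Implicit Arguments.
Unset Strict Implicit.
Unset Printing Implicit Defensive.

(** * The Hales-Jewett theorem *)

Section HalesJewett.

Variable T : finType.

Definition fill (I : finType) (L : {ffun I -> option T}) (a : T) :
  {ffun I -> T} := [ffun i => odflt a (L i)].

Definition join (U : Type) (I J : finType) (f : {ffun I -> U})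
    (g : {ffun J -> U}) : {ffun I + J -> U} :=
  [ffun k => match k with inl i => f i | inr j => g j end].

Definition rigid (I : finType) (w : {ffun I -> T}) : {ffun I -> option T} :=
  [ffun i => Some (w i)].

Definition line (I : finType) (L : {ffun I -> option T}) : bool :=
  [exists i, L i == None].

Lemma fill_join (I J : finType) (L : {ffun I -> option T})
    (M : {ffun J -> option T}) a :
  fill (join L M) a = join (fill L a) (fill M a).
Proof. by apply/ffunP => -[i|j]; rewrite !ffunE. Qed.

Lemma fill_rigid (I : finType) (w : {ffun I -> T}) a : fill (rigid w) a = w.
Proof. by apply/ffunP => i; rewrite !ffunE. Qed.

Lemma line_joinl (I J : finType) (L : {ffun I -> option T})
    (M : {ffun J -> option T}) : line L -> line (join L M).
Proof. by case/existsP=> i Li; apply/existsP; exists (inl i); rewrite ffunE. Qed.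

Lemma line_joinr (I J : finType) (L : {ffun I -> option T})
    (M : {ffun J -> option T}) : line M -> line (join L M).
Proof. by case/existsP=> i Li; apply/existsP; exists (inr i); rewrite ffunE. Qed.

Definition mono (K : Type) (S : seq T) (I : finType)
    (C : {ffun I -> T} -> K) (L : {ffun I -> option T}) : Prop :=
  {in S &, forall a b, C (fill L a) = C (fill L b)}.

(** Words use the whole alphabet, only the letters substituted in a line are
restricted to [S]: this allows an induction on [S] inside a fixed alphabet. *)
Definition hales_jewett_for (S : seq T) (K : finType) (I : finType) : Prop :=
  forall C : {ffun I -> T} -> K, exists2 L, line L & mono S C L.

(** The head of [S] represents all letters of [S], on which every line of [Ls] has
one colour; for empty [S] the letter [x] itself serves.  The word [w] is the
focus. *)
Definition focused (K : eqType) (x : T) (S : seq T) (I : finType)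
    (C : {ffun I -> T} -> K) (r : nat) : Prop :=
  exists (w : {ffun I -> T}) (Ls : seq {ffun I -> option T}),
    [/\ size Ls = r, {in Ls, forall L, line L},
        {in Ls, forall L, fill L x = w}, {in Ls, forall L, mono S C L}
      & uniq [seq C (fill L (head x S)) | L <- Ls]].

(** Colour focusing.  Colouring a word [v] over [J] by the whole function
[w |-> C (w, v)], which is where arbitrary colour sets are needed, gives a line
[M] along which the letters of [S] cannot be distinguished, so that [C] induces
a colouring [C'] of the words over [I].  If the focus [w] of lines for [C'] has
the colour of one of them, that line is constant on [x :: S].  Otherwise all
lines are extended by [M], and [w] followed by [M] is a further one with a new
colour. *)
Lemma focusing_step (K : finType) x S r (I J : finType) :
    (forall C : {ffun I -> T} -> K,
       focused x S C r \/ exists2 L, line L & mono (x :: S) C L) ->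
    hales_jewett_for S {ffun {ffun I -> T} -> K} J ->
  forall C : {ffun I + J -> T} -> K,
    focused x S C r.+1 \/ exists2 L, line L & mono (x :: S) C L.
Proof.
move=> focI hjJ C; set a0 := head x S.
have a0S a : a \in S -> a0 \in S.
  by rewrite /a0; case: (S) => //= b s; rewrite mem_head.
have [M lineM monoM] :=
  hjJ (fun v => [ffun w => C (join w v)] : {ffun {ffun I -> T} -> K}).
pose C' w := C (join w (fill M a0)).
have C'E w a : a \in S -> C (join w (fill M a)) = C' w.
  move=> aS; have /ffunP/(_ w) := monoM a a0 aS (a0S a aS).
  by rewrite !ffunE.
(* A line for C' is made one for C by substituting the letter a0 in M. *)
have [[w [Ls [szLs lineLs fillLs monoLs uniqLs]]]|[L lineL monoL]] := focI C';
  last first.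
  right; exists (join L (rigid (fill M a0))); first exact: line_joinl.
  by move=> a b aS bS; rewrite !fill_join !fill_rigid; apply: monoL.
have [/mapP[L LLs wL]|new] :=
    boolP (C' w \in [seq C' (fill L a0) | L <- Ls]).
  right; exists (join L (rigid (fill M a0))); first exact/line_joinl/lineLs.
  suff eqw a : a \in x :: S -> C' (fill L a) = C' w.
    by move=> a b aS bS; rewrite !fill_join !fill_rigid -!/(C' _) !eqw.
  rewrite inE => /predU1P[->|aS]; first by rewrite fillLs.
  by rewrite wL; apply: monoLs => //; apply: a0S aS.
left; exists (join w (fill M x)).
exists (join (rigid w) M :: [seq join L M | L <- Ls]).
split.
- by rewrite /= size_map szLs.
- move=> _ /predU1P[->|/mapP[L LLs ->]]; first exact: line_joinr.
  exact: line_joinr.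
- move=> _ /predU1P[->|/mapP[L LLs ->]]; rewrite fill_join ?fill_rigid //.
  by rewrite fillLs.
- move=> _ /predU1P[->|/mapP[L LLs ->]] a b aS bS; rewrite !fill_join.
    by rewrite !fill_rigid !C'E.
  by rewrite !C'E //; apply: monoLs.
- rewrite /= -map_comp.
  rewrite (@eq_map _ _ _ (fun L => C' (fill L a0))); last first.
    by move=> L /=; rewrite fill_join.
  by rewrite fill_join fill_rigid -/(C' w) new uniqLs.
Qed.

Lemma hales_jewett_letters (S : seq T) :
  forall K : finType, {I : finType | hales_jewett_for S K I}.
Proof.
elim: S => [|x S IHS] K.
  exists unit => C; exists [ffun=> None] => //.
  by apply/existsP; exists tt; rewrite ffunE.
have foc r : {I : finType | forall C : {ffun I -> T} -> K,
    focused x S C r \/ exists2 L, line L & mono (x :: S) C L}.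
  elim: r => [|r [I focI]].
    by exists unit => C; left; exists [ffun=> x], [::].
  have [J hjJ] := IHS {ffun {ffun I -> T} -> K}.
  by exists (I + J : finType)%type; apply: focusing_step focI hjJ.
(* More focused lines than colours are impossible. *)
have [I focI] := foc #|K|.+1; exists I => C.
have [[w [Ls [szLs _ _ _ uniqLs]]]|//] := focI C.
have := max_card (mem [seq C (fill L (head x S)) | L <- Ls]).
by rewrite (card_uniqP uniqLs) size_map szLs ltnn.
Qed.

Lemma hales_jewett (K : finType) :
  {I : finType | forall C : {ffun I -> T} -> K,
     exists2 L, line L & forall a b, C (fill L a) = C (fill L b)}.
Proof.
have [I hjI] := hales_jewett_letters (enum T) K; exists I => C.
have [L lineL monoL] := hjI C; exists L => // a b.
by apply: monoL; rewrite mem_enum.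
Qed.

End HalesJewett.

(** * The finite Ramsey theorem *)

Section Ramsey.

Variables (T : eqType) (K : finType).

Definition homogeneous (k : nat) (c : seq T -> K) (h : seq T) (i : K) : Prop :=
  forall s, subseq s h -> size s = k -> c s = i.

(** The colour of a [k.+1]-subsequence of [h] depends only on its first entry. *)
Fixpoint prehom (k : nat) (c : seq T -> K) (h : seq T) : Prop :=
  if h is x :: t then
    (exists i, homogeneous k (fun s => c (x :: s)) t i) /\ prehom k c t
  else True.

(** The pigeonhole principle on the colours of the entries of [h].  Lowering the
demand [d] at the colour of the head makes the induction go through. *)
Lemma prehom_homogeneous k c h (d : K -> nat) :
    prehom k c h -> \sum_i d i <= size h ->
  exists i h', [/\ subseq h' h, size h' = d i & homogeneous k.+1 c h' i].
Proof.
elim: h d => [|x h IHh] d /= => [_|[[i homi] preh] sumd].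
  rewrite leqn0 sum_nat_eq0 => /forallP d0.
  exists (c [::]), [::]; split=> //; first by rewrite (eqP (implyP (d0 _) isT)).
  by move=> s; rewrite subseq0 => /eqP->.
have [di0|di_gt0] := posnP (d i).
  by exists i, [::]; split; rewrite ?sub0seq // => s; rewrite subseq0 => /eqP->.
pose d' j := d j - (j == i).
have sumd' : (\sum_j d' j).+1 = \sum_j d j.
  rewrite (bigD1 i) //= [RHS](bigD1 i) //= {1}/d' eqxx subn1 -addSn prednK //.
  congr (_ + _).
  by apply: eq_bigr => j /negPf neq_ji; rewrite /d' neq_ji subn0.
have [||j [h' [sub_h' sz_h' hom_h']]] := IHh d' => //; first by rewrite -ltnS sumd'.
have [eq_ji|neq_ji] := eqVneq j i; last first.
  exists j, h'; split=> //; last by rewrite sz_h' /d' (negPf neq_ji) subn0.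
  exact: subseq_trans (subseq_cons h x).
rewrite {}eq_ji in sz_h' hom_h'.
exists i, (x :: h'); split; rewrite /= ?eqxx //.
  by rewrite sz_h' /d' eqxx subn1 prednK.
move=> [|y s] //=; have [-> sub_s [sz_s]|_ sub_s sz_s] := eqVneq y x.
  by apply: homi => //; apply: subseq_trans sub_h'.
exact: hom_h'.
Qed.

(** Induction on [k]: a prehomogeneous subsequence is built entry by entry, using
the statement for [k] on the colouring of the continuations of each entry, and
then thinned out by pigeonhole. *)
Lemma ramsey k : forall m, {p | forall g : seq T, p <= size g ->
  forall c : seq T -> K, exists i h,
    [/\ subseq h g, size h = m & homogeneous k c h i]}.
Proof.
elim: k => [|k IHk] m.
  exists m => g le_mg c; exists (c [::]), (take m g); split.
  - exact: take_subseq.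
  - exact: size_takel.
  - by move=> s _ /size0nil->.
have [p preP] : {p | forall g : seq T, p <= size g -> forall c : seq T -> K,
    exists h, [/\ subseq h g, size h = #|K| * m & prehom k c h]}.
  elim: (#|K| * m) => [|q [p preP]].
    by exists 0 => g _ c; exists [::]; rewrite sub0seq.
  have [p' homP] := IHk p; exists p'.+1 => -[//|x g] /= le_p'g c.
  have [i [h1 [sub_h1 sz_h1 hom_h1]]] := homP g le_p'g (fun s => c (x :: s)).
  have [|h2 [sub_h2 sz_h2 pre_h2]] := preP h1 _ c; first by rewrite sz_h1.
  exists (x :: h2); split; rewrite /= ?eqxx ?sz_h2 //.
    exact: subseq_trans sub_h1.
  split=> //; exists i => s sub_s; apply: hom_h1.
  exact: subseq_trans sub_h2.
exists p => g le_pg c; have [h [sub_h sz_h pre_h]] := preP g le_pg c.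
have [|i [h' [sub_h' sz_h' hom_h']]] := @prehom_homogeneous k c h (fun=> m) pre_h.
  by rewrite sum_nat_const sz_h.
by exists i, h'; split=> //; apply: subseq_trans sub_h.
Qed.

End Ramsey.

(** * Graphs with two relations *)

(** The relation [edge true] is R and [edge false] is N.  They need not be
disjoint: in the chain from which the construction starts both are [<]. *)
Record bigraph := Bigraph {
  bvert :> finType;
  edge : bool -> rel bvert
}.

Definition hom (G H : bigraph) (f : G -> H) : bool :=
  [forall b, forall x, forall y, edge b x y ==> edge b (f x) (f y)].

Lemma homP (G H : bigraph) (f : G -> H) :
  reflect (forall b x y, edge b x y -> edge b (f x) (f y)) (hom f).
Proof.
apply: (iffP forallP) => [hf b x y|hf b].
  by have /forallP/(_ x)/forallP/(_ y)/implyP := hf b.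
by apply/forallP => x; apply/forallP => y; apply/implyP/hf.
Qed.

(** A bad quasicycle on the [j.+1] vertices [z 0], ..., [z j].  Functions on
[nat] make shortcuts and segments easy to write, and [j = 0] gives the loops
of N. *)
Definition quasicycle (G : bigraph) (j : nat) (z : nat -> G) : Prop :=
  (forall i, i < j -> edge true (z i) (z i.+1)) /\ edge false (z 0) (z j).

Definition qcfree (l : nat) (G : bigraph) : Prop :=
  forall j z, j < l -> ~ @quasicycle G j z.

Definition oriented (G : bigraph) : Prop :=
  forall b c (x y : G), edge b x y -> ~~ edge c y x.

Definition semicomplete (G : bigraph) : Prop :=
  forall x y : G, x != y -> exists b, edge b x y || edge b y x.

Definition increasing (G : bigraph) (le : rel G) : Prop :=
  forall b x y, edge b x y -> le x y && (x != y).

Section Basics.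

Variable G : bigraph.

Lemma qcfree_le l m : m <= l -> qcfree l G -> qcfree m G.
Proof. by move=> le_ml freeG j z ltjm; apply: freeG; apply: leq_trans le_ml. Qed.

Lemma qcfree2_disjoint (x y : G) :
  qcfree 2 G -> edge true x y -> ~~ edge false x y.
Proof.
move=> freeG Rxy; apply/negP => Nxy.
by apply: (freeG 1 (fun i => if i is 0 then x else y)) => //; split=> // -[].
Qed.

Lemma increasing_oriented (le : rel G) :
  linear_order le -> increasing le -> oriented G.
Proof.
case=> _ anti _ _ incG b c x y /incG/andP[le_xy neq_xy].
apply: contra neq_xy => /incG/andP[le_yx _].
by apply/eqP/anti; rewrite le_xy.
Qed.

Lemma oriented_irr (x : G) b : oriented G -> ~~ edge b x x.
Proof. by move=> orG; apply/negP => Ex; have := orG _ b _ _ Ex; rewrite Ex. Qed.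

End Basics.

Section Homomorphisms.

Variables G H : bigraph.
Implicit Type f : G -> H.

Lemma hom_oriented f : hom f -> oriented H -> oriented G.
Proof.
move=> /homP hf orH b c x y /hf Exy.
by apply: contra (orH b c _ _ Exy); apply: hf.
Qed.

Lemma hom_quasicycle f j z :
  hom f -> quasicycle j z -> quasicycle j (f \o z).
Proof.
by move=> /homP hf [Rz Nz]; split=> [i ltij|]; apply: hf => //; apply: Rz.
Qed.

Lemma hom_qcfree f l : hom f -> qcfree l H -> qcfree l G.
Proof. by move=> hf freeH j z ltjl /(hom_quasicycle hf); apply: freeH. Qed.

Lemma hom_inj f : semicomplete G -> oriented H -> hom f -> injective f.
Proof.
move=> comG orH /homP hf x y eq_fxy; apply/eqP/negP => /negP/comG[b].
by case/orP=> /hf; rewrite eq_fxy => Ey; have := oriented_irr (f y) b orH; rewrite Ey.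
Qed.

(** Two distinct vertices of [G] are joined by some edge; its image would oppose
or duplicate the given edge if it had the other direction or kind. *)
Lemma hom_reflect f b x y : semicomplete G -> oriented H -> qcfree 2 H ->
  hom f -> edge b (f x) (f y) -> edge b x y.
Proof.
move=> comG orH freeH /homP hf Exy.
have /comG[c] : x != y.
  by apply: contraTneq Exy => ->; apply: oriented_irr.
case/orP=> [Ec|/hf Ec]; last by have := orH _ c _ _ Exy; rewrite Ec.
have Ecf := hf _ _ _ Ec.
case: b c Exy Ec Ecf => -[] // Exy _ Ecf.
  by have := qcfree2_disjoint freeH Exy; rewrite Ecf.
by have := qcfree2_disjoint freeH Ecf; rewrite Exy.
Qed.

End Homomorphisms.

Lemma hom_comp (F G H : bigraph) (f : F -> G) (g : G -> H) :
  hom f -> hom g -> hom (g \o f).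
Proof. by move=> /homP hf /homP hg; apply/homP => b x y /hf; apply: hg. Qed.

Lemma eq_hom (G H : bigraph) (f g : G -> H) : f =1 g -> hom f = hom g.
Proof.
move=> eq_fg; apply/homP/homP => h b x y /h; by rewrite !eq_fg.
Qed.

(** * Bad quasicycles and gluing *)

Section Chords.

Variables (A V : bigraph) (le : rel V) (l : nat) (f : A -> V).
Hypotheses (leV : linear_order le) (incV : increasing le).
Hypotheses (comA : semicomplete A) (homf : hom f) (freeV : qcfree l V).

Lemma path_increasing j (z : nat -> V) :
    (forall i, i < j -> edge true (z i) (z i.+1)) ->
  forall a b, a < b <= j -> le (z a) (z b) && (z a != z b).
Proof.
have [_ anti tr _] := leV => Rz a b /andP[]; elim: b => // b IHb.
rewrite ltnS leq_eqVlt => /predU1P[->|ltab] lebj; first exact/incV/Rz.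
have /andP[le_ab neq_ab] := IHb ltab (ltnW lebj).
have /andP[le_bS neq_bS] := incV (Rz b lebj).
rewrite (tr _ _ _ le_ab le_bS); apply: contra neq_bS => /eqP eq_aS.
by apply/eqP/anti; rewrite le_bS -eq_aS.
Qed.

(** The edge of [A] between the preimages of [z a] and [z b] gives an edge of [V].
If it is in R it is a shortcut of the quasicycle, if it is in N it closes the
segment from [a] to [b]; both are bad quasicycles with fewer vertices. *)
Lemma no_chord (z : nat -> V) a b : quasicycle l z ->
  a.+1 < b <= l -> b - a < l -> z a \in codom f -> z b \in codom f -> False.
Proof.
move=> [Rz Nz] /andP[ltab lebl] ltl /codomP[u zaE] /codomP[v zbE].
have [|le_ab neq_ab] := andP (path_increasing Rz (a := a) (b := b) _).
  by rewrite lebl ltnW.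
have neq_uv : u != v by apply: contraNneq neq_ab => eq_uv; rewrite zaE zbE eq_uv.
have [c /orP[|] /(homP _ homf)] := comA neq_uv; rewrite -zaE -zbE => Ec; last first.
  have [_ anti _ _] := leV; have /andP[le_ba _] := incV Ec.
  by case/negP: neq_ab; apply/eqP/anti; rewrite le_ab.
case: c Ec => Ec; last first.
  apply: (freeV (j := b - a) (z := fun i => z (a + i))) => //; split.
    by move=> i lti; rewrite addnS; apply: Rz; lia.
  by rewrite addn0 subnKC //; lia.
(* The shortcut leaves out the d vertices strictly between a and b. *)
pose d := b - a.+1.
apply: (freeV (j := l - d) (z := fun i => z (if i <= a then i else i + d))).
  by rewrite /d; lia.
split=> [i lti|] /=; last first.
  by case: ifP => [|_]; [rewrite /d; lia|rewrite subnK //; rewrite /d; lia].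
have [lt_ia|lt_ai|->] := ltngtP i a.
- by apply: Rz; lia.
- by rewrite addSn; apply: Rz; lia.
- by rewrite (_ : a.+1 + d = b) // /d; lia.
Qed.

End Chords.

(** A set covered by pieces [inY L] any two of which meet only inside [U]. *)
Section Cover.

Variables (X Y : Type) (inY : Y -> X -> Prop) (U : pred X).
Hypothesis meetU : forall L M x, inY L x -> inY M x -> U x \/ L = M.

Definition linked (x y : X) : Prop := exists L, inY L x /\ inY L y.

(** A walk can leave the piece [L] only at a vertex of [U]. *)
Lemma linked_walk L (y : nat -> X) d :
    (forall i, i < d -> linked (y i) (y i.+1)) -> inY L (y 0) -> ~~ U (y 0) ->
  inY L (y d) \/ exists2 u, 0 < u < d & U (y u).
Proof.
elim: d => [|d IHd] linky Ly0 Uy0; first by left.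
have [|Lyd|[u /andP[u_gt0 ltud] Uu]] := IHd _ Ly0 Uy0; last first.
- by right; exists u; rewrite // u_gt0 ltnW.
- have [d0|d_gt0] := posnP d; last first.
    have [Ud|nUd] := boolP (U (y d)); first by right; exists d; rewrite // d_gt0 /=.
    have [M [Md MSd]] := linky d (ltnSn d).
    by have [|->] := meetU Lyd Md; [rewrite (negPf nUd)|left].
  have [M [Md MSd]] := linky d (ltnSn d).
  have [|->] := meetU Lyd Md; last by left.
  by rewrite d0 (negPf Uy0).
by move=> i ltid; apply: linky; apply: ltnW.
Qed.

(** From a vertex [z k] outside [U], walk around the cycle to any [z m] in both
directions.  If neither walk stays in the piece of [z k], each meets [U] before
reaching [z m]; these two vertices of [U] are separated by [z k] and [z m], so
they are not neighbours on the cycle. *)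
Lemma linked_cycle l (z : nat -> X) k :
    (forall i, i < l -> linked (z i) (z i.+1)) -> linked (z l) (z 0) ->
    (forall a b, a.+1 < b <= l -> b - a < l -> U (z a) -> U (z b) -> False) ->
    k <= l -> ~~ U (z k) ->
  exists L, forall i, i <= l -> inY L (z i).
Proof.
move=> linkz linkl0 chordU lekl Uk.
(* The sequence z wound around the cycle, so that walks need no case split. *)
pose cz i := z (i %% l.+1).
have czS i : linked (cz i) (cz i.+1).
  rewrite /cz modnS; have := ltn_mod i l.+1; rewrite /= ltnS leq_eqVlt.
  case: ifP => [|ndv].
    case/dvdnP=> q iE /orP[/eqP->//|lti].
    have: i.+1 %% l.+1 = 0 by rewrite iE modnMl.
    by rewrite -addn1 -modnDml addn1 modn_small.
  case/orP=> [/eqP il|/linkz//]; case/negP: (negbT ndv).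
  by rewrite /dvdn -addn1 -modnDml il addn1 modnn.
have chord a b : a.+1 < b -> b - a < l -> b < k + l.+1 -> U (cz a) -> U (cz b) -> False.
  rewrite /cz => ltab ltl ltb; have [lta|gea] := ltnP a l.+1; last first.
    rewrite -(subnKC gea) modnDl modn_small; last by lia.
    rewrite -[b](@subnKC l.+1); last by lia.
    by rewrite modnDl modn_small; [apply: chordU|]; lia.
  rewrite (modn_small lta); have [ltb'|geb] := ltnP b l.+1.
    by rewrite (modn_small ltb'); apply: chordU; lia.
  rewrite -(subnKC geb) modnDl modn_small; last by lia.
  by move=> Ua Ub; apply: chordU Ub Ua; lia.
have [L [Lk _]] := czS k.
have czk : cz k = z k by rewrite /cz modn_small.
exists L => m leml; pose m' := if m < k then m + l.+1 else m.
have czm : cz m' = z m.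
  by rewrite /m' /cz; case: ifP => _; rewrite ?modnDr modn_small.
have le_km' : k <= m' by rewrite /m'; case: ifP; lia.
have lt_m' : m' < k + l.+1 by rewrite /m'; case: ifP; lia.
have [||||[u ltu Uu]] := @linked_walk L (fun i => cz (k + i)) (m' - k).
- by move=> i _; rewrite addnS.
- by rewrite addn0.
- by rewrite addn0 czk.
- by rewrite subnKC // czm.
have [||||[w ltw Uw]] := @linked_walk L (fun i => cz (k + l.+1 - i)) (k + l.+1 - m').
- move=> i lti; have [M [M1 M2]] := czS (k + l.+1 - i.+1).
  by exists M; split=> //; move: M2; congr inY; congr cz; lia.
- by rewrite subn0 /cz modnDr; rewrite /cz in Lk.
- by rewrite subn0 /cz modnDr -/(cz k) czk.
- by rewrite subKn ?czm // ltnW.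
by case: (chord _ _ _ _ _ Uu Uw); lia.
Qed.

End Cover.

(** * One amalgamation *)

Section Amalgam.

Variables (A V P : bigraph) (p : P -> V) (f : {ffun A -> V}).
Variables (I : finType) (i0 : I).

Definition lifts (a : {ffun A -> P}) : bool :=
  hom a && [forall u, p (a u) == f u].

Lemma liftsP (a : {ffun A -> P}) :
  reflect (hom a /\ forall u, p (a u) = f u) (lifts a).
Proof.
apply: (iffP andP) => -[homa pa]; split=> //.
  by move=> u; apply/eqP; apply: (forallP pa).
by apply/forallP => u; rewrite pa.
Qed.

Definition lifting : finType := {a : {ffun A -> P} | lifts a}.

(** The copy of [P] in the amalgam belonging to the line [L].  A vertex [x] over
the vertex [f u] becomes the line [L] itself with [x] substituted: its fixed
coordinates are the lifts of [f] evaluated at [u].  Such vertices are shared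
between copies, the others carry [L] as a label. *)
Definition copy (L : {ffun I -> option lifting}) (x : P) :
    {ffun I -> P} * option {ffun I -> option lifting} :=
  ([ffun i => if L i is Some a then
                if [pick u | f u == p x] is Some u then val a u else x
              else x],
   if p x \in codom f then None else Some L).

(** The vertices outside all copies are isolated, hence harmless. *)
Definition amalgam : bigraph :=
  @Bigraph ({ffun I -> P} * option {ffun I -> option lifting})%type
    (fun b z w => [exists L, line L &&
       [exists x, exists y, [&& copy L x == z, copy L y == w & edge b x y]]]).

Definition amalgam_proj (z : amalgam) : V := p (z.1 i0).

Lemma amalgamP b (z w : amalgam) :
  reflect (exists L x y, [/\ line L, copy L x = z, copy L y = w & edge b x y])
          (edge b z w).
Proof.
apply: (iffP existsP) => [[L /andP[lineL]]|[L [x [y [lineL xz yw Exy]]]]].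
  case/existsP=> x /existsP[y /and3P[/eqP xz /eqP yw Exy]].
  by exists L, x, y.
exists L; rewrite lineL; apply/existsP; exists x; apply/existsP; exists y.
by rewrite xz yw !eqxx.
Qed.

Lemma amalgam_projK L x : amalgam_proj (copy L x) = p x.
Proof.
rewrite /amalgam_proj ffunE; case: (L i0) => [a|//].
case: pickP => [u /eqP <-|//]; by have [_ ->] := liftsP _ (valP a).
Qed.

Lemma copy_inj L : line L -> injective (copy L).
Proof.
case/existsP=> i /eqP Li x y [/ffunP/(_ i)]; by rewrite !ffunE Li.
Qed.

Lemma copy_hom L : line L -> hom (copy L : P -> amalgam).
Proof.
by move=> lineL; apply/homP => b x y Exy; apply/amalgamP; exists L, x, y.
Qed.

Lemma copy_meet L M x y : copy L x = copy M y -> p x \in codom f \/ L = M.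
Proof.
move=> eq_copy; have := congr1 amalgam_proj eq_copy; rewrite !amalgam_projK.
case: eq_copy => _ + eq_p; rewrite -eq_p.
by case: ifP => [_ _|_ [->]]; [left|right].
Qed.

Hypotheses (comA : semicomplete A) (orV : oriented V) (homp : hom p).
Hypothesis homf : hom f.
Hypothesis freeP : qcfree 2 P.

(** If the same edge comes also from the copy of another line [M], its ends lie
over some [f u] and [f v].  At an active coordinate of [L] the ends are [x] and
[y] themselves or come from a lift of [f]; at an active coordinate of [M] the
same holds for [x'] and [y'].  Unless the two pairs are equal, both edges are
images of the one between [u] and [v] under lifts, which reflect edges. *)
Lemma copy_reflect b L x y : line L ->
  edge b (copy L x : amalgam) (copy L y) -> edge b x y.
Proof.
move=> lineL /amalgamP[M [x' [y' [lineM xx' yy' Ex'y']]]].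
have [eq_LM|neq_LM] := eqVneq M L.
  by move: xx' yy' Ex'y'; rewrite eq_LM => /(copy_inj lineL)-> /(copy_inj lineL)->.
have orP := hom_oriented homp orV.
have px := congr1 amalgam_proj xx'; have py := congr1 amalgam_proj yy'.
rewrite !amalgam_projK in px py.
have [/codomP[u pxu]|eq_LM] := copy_meet xx'; last by rewrite eq_LM eqxx in neq_LM.
have [/codomP[v pyv]|eq_LM] := copy_meet yy'; last by rewrite eq_LM eqxx in neq_LM.
(* Coordinates of a vertex over f w; f is injective, so w is determined. *)
have coord (N : {ffun I -> option lifting}) i s w : p s = f w ->
    (copy N s).1 i = if N i is Some a then val a w else s.
  move=> psw; rewrite ffunE; case: (N i) => // a; case: pickP => [w'|/(_ w)].
    by rewrite psw => /eqP/(hom_inj comA orV homf)->.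
  by rewrite psw eqxx.
have xi i : (if M i is Some a then val a u else x') =
            (if L i is Some a then val a u else x).
  by rewrite -(coord M i x' u) // xx' (coord L i x u) // -px.
have yi i : (if M i is Some a then val a v else y') =
            (if L i is Some a then val a v else y).
  by rewrite -(coord M i y' v) // yy' (coord L i y v) // -py.
have [/existsP[i /eqP Li] /existsP[j /eqP Mj]] := (lineL, lineM).
move: (xi i) (yi i) (xi j) (yi j).
rewrite Li Mj; case: (M i) => [a|<- <- //]; case: (L j) => [c|] <- <-; last first.
  by move=> <- <-.
move=> x'E y'E; rewrite x'E y'E in Ex'y'.
have [[homa _] [homc _]] := (liftsP _ (valP a), liftsP _ (valP c)).
have Euv := hom_reflect comA orP freeP homc Ex'y'.
exact: (homP _ homa).
Qed.

Lemma amalgam_hom : hom amalgam_proj.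
Proof.
apply/homP => b z w /amalgamP[L [x [y [_ <- <- Exy]]]].
by rewrite !amalgam_projK; apply: (homP _ homp).
Qed.

(** A quasicycle on [l.+1] vertices lies in a single copy of [P], by [no_chord]
and [linked_cycle], if it has a vertex outside the glued part.  Otherwise
[no_chord] forces [l = 2] and the quasicycle projects to a triangle in the image
of [f], which [A] does not contain.  For [l = 1] the copy containing the N-edge
is induced and so contains the R-edge as well. *)
Lemma amalgam_qcfree (le : rel V) l : linear_order le -> increasing le ->
  qcfree 3 A -> 0 < l -> qcfree l V -> qcfree l.+1 P -> qcfree l.+1 amalgam.
Proof.
move=> leV incV freeA l_gt0 freeV freeSP j z; rewrite ltnS leq_eqVlt.
case/predU1P=> [->{j}|/freeV noV /(hom_quasicycle amalgam_hom)/noV//] badz.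
pose inC (L : {ffun I -> option lifting}) (w : amalgam) :=
  line L /\ exists x, copy L x = w.
(* Once in a single copy, the quasicycle can be pulled back to P. *)
suff [L inL] : exists L, forall i, i <= l -> inC L (z i).
  have lineL : line L by case: (inL 0).
  have [x0 _] := (inL 0 isT).2.
  pose y i := odflt x0 [pick x | copy L x == z i].
  have yE i : i <= l -> copy L (y i) = z i.
    move=> leil; rewrite /y; case: pickP => [x /eqP//|nox].
    by have [_ [x /eqP xE]] := inL i leil; rewrite nox in xE.
  case: badz => Rz Nz; apply: (freeSP l y) => //; split.
    by move=> i ltil; apply: (copy_reflect lineL); rewrite !yE ?Rz // ltnW.
  by apply: (copy_reflect lineL); rewrite !yE.
have linked_edge b v w : edge b v w -> linked inC v w.
  case/amalgamP=> L [x [y [lineL <- <- _]]].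
  by exists L; split; split=> //; [exists x|exists y].
have [Rz Nz] := badz; have badpz := hom_quasicycle amalgam_hom badz.
have [l1|l_neq1] := eqVneq l 1.
  have [L [L0 L1]] := linked_edge _ _ _ Nz; exists L => -[//|i] leil.
  by move: leil L1; rewrite l1 ltnS leqn0 => /eqP->.
have l_gt1 : 1 < l by rewrite ltn_neqAle eq_sym l_neq1.
pose U : pred amalgam := [pred w | amalgam_proj w \in codom f].
have chord a b : a.+1 < b <= l -> b - a < l -> U (z a) -> U (z b) -> False.
  exact: (no_chord leV incV comA homf freeV badpz).
have [/existsP[k Uk]|allU] := boolP [exists k : 'I_l.+1, ~~ U (z k)].
  have leql : k <= l by rewrite -ltnS.
  apply: (linked_cycle (U := U)) chord leql Uk.
  - move=> L M _ [_ [x <-]] [_ [y]] /esym/copy_meet; rewrite /U /= amalgam_projK.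
    exact.
  - by move=> i ltil; apply: linked_edge (Rz i ltil).
  - by have [L [L0 Ll]] := linked_edge _ _ _ Nz; exists L.
have allz i : i <= l -> U (z i).
  rewrite negb_exists in allU; move=> leil.
  by have := forallP allU (inord i); rewrite inordK // negbK.
have l2 : l = 2.
  apply/eqP; rewrite eqn_leq l_gt1 andbT leqNgt; apply/negP => l_gt2.
  by apply: (chord 0 2); rewrite ?allz //; lia.
have uE i : i <= l -> {u | f u = amalgam_proj (z i)}.
  by move=> /allz Uz; exists (iinv Uz); rewrite f_iinv.
have reflect_edge b u v : edge b (f u) (f v) -> edge b u v.
  by apply: (hom_reflect comA orV _ homf); apply: qcfree_le freeV; rewrite l2.
subst l; have [[u0 u0E] [u1 u1E]] := (uE 0 isT, uE 1 isT).
have [u2 u2E] := uE 2 isT.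
case: (freeA 2 (fun i => if i is i'.+1 then if i' is 0 then u1 else u2 else u0)) => //.
case: badpz => Rpz Npz; split; last by apply: reflect_edge; rewrite u0E u2E.
case=> [|[|//]] _; apply: reflect_edge.
  by rewrite u0E u1E; apply: (Rpz 0).
by rewrite u1E u2E; apply: (Rpz 1).
Qed.

(** A word over the alphabet of lifts is a map [A -> amalgam], which gives its
colour.  The points of a line [L] are the images in [copy L] of the lifts. *)
Lemma amalgam_ramsey (K : Type) :
    (forall C : {ffun I -> lifting} -> K,
       exists2 L, line L & forall a b, C (fill L a) = C (fill L b)) ->
  forall chi : {ffun A -> amalgam} -> K, exists e : P -> amalgam,
    [/\ hom e, forall x, amalgam_proj (e x) = p x
      & forall a b, lifts a -> lifts b ->
          chi [ffun u => e (a u)] = chi [ffun u => e (b u)]].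
Proof.
move=> hjI chi.
have [L lineL monoL] := hjI (fun w => chi [ffun u => ([ffun i => val (w i) u], None)]).
exists (copy L); split=> [|x|a b la lb]; first exact: copy_hom.
  exact: amalgam_projK.
suff copyE c (lc : lifts c) : [ffun u => copy L (c u)] =
    [ffun u => ([ffun i => val (fill L (exist _ c lc) i) u], None)].
  by rewrite (copyE a la) (copyE b lb); apply: monoL.
have [_ pc] := liftsP _ lc.
apply/ffunP => u; rewrite !ffunE /copy pc codom_f; congr (_, _).
apply/ffunP => i; rewrite !ffunE; case: (L i) => [d|] //=.
case: pickP => [v /eqP/(hom_inj comA orV homf)->//|/(_ u)].
by rewrite eqxx.
Qed.

End Amalgam.

(** * The partite construction *)

(** The Ramsey property for homomorphisms instead of copies. *)
Definition hom_arrows (K : Type) (V B A : bigraph) : Prop :=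
  forall chi : {ffun A -> V} -> K, exists2 g : B -> V, hom g &
    forall a b : {ffun A -> B}, hom a -> hom b ->
      chi [ffun u => g (a u)] = chi [ffun u => g (b u)].

Section PartiteConstruction.

Variables (A B V : bigraph) (K : finType) (i0 : K) (le : rel V) (l : nat).
Hypotheses (comA : semicomplete A) (freeA : qcfree 3 A).
Hypothesis freeB : forall j, qcfree j B.
Hypotheses (leV : linear_order le) (incV : increasing le).
Hypotheses (l_gt0 : 0 < l) (freeV : qcfree l V).

Let orV : oriented V := increasing_oriented leV incV.

(** The colourings are met in reverse order: a colouring of [Q] first yields a
copy of the amalgam for [f] in which the other positions are already settled,
and this copy induces a colouring to which [amalgam_ramsey] applies. *)
Lemma iterated_amalgam (fs : seq {ffun A -> V}) (P : bigraph) (p : P -> V) :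
    all (fun f : {ffun A -> V} => hom f) fs -> hom p -> qcfree l.+1 P ->
  {Q : bigraph & {q : Q -> V | [/\ hom q, qcfree l.+1 Q &
     forall chi : {ffun A -> Q} -> K, exists e : P -> Q,
       [/\ hom e, forall x, q (e x) = p x &
           {in fs, forall f (a b : {ffun A -> P}), lifts p f a -> lifts p f b ->
              chi [ffun u => e (a u)] = chi [ffun u => e (b u)]}]]}}.
Proof.
elim: fs P p => [|f fs IHfs] P p.
  by move=> _ homp freeP; exists P, p; split=> // chi; exists id; split=> //; apply/homP.
case/andP=> homf homfs homp freeP.
have [I hjI] := hales_jewett (lifting p f) K.
have [i _|noI] := pickP (fun _ : I => true); last first.
  by exfalso; have [L /existsP[i]] := hjI (fun=> i0); have := noI i.
have free2P : qcfree 2 P by apply: qcfree_le freeP; rewrite ltnS.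
have [|||Q [q [homq freeQ ramQ]]] := IHfs (amalgam p f I) (amalgam_proj i) => //.

- exact: amalgam_hom.
- exact: (amalgam_qcfree i comA orV homp homf free2P leV incV).
exists Q, q; split=> // chi; have [e [home qe mono_e]] := ramQ chi.
have [d [homd pd mono_d]] :=
  amalgam_ramsey i comA orV homf hjI (fun a => chi [ffun u => e (a u)]).
exists (e \o d); split; first exact: hom_comp home.
  by move=> x /=; rewrite qe pd.
move=> f'; rewrite inE => /predU1P[->|f'fs] a b la lb; last first.
  have ld c : lifts p f' c -> lifts (amalgam_proj i) f' [ffun u => d (c u)].
    move=> /liftsP[homc pc]; apply/liftsP; split; last by move=> u; rewrite ffunE pd.
    rewrite (@eq_hom _ _ _ (d \o c)); first exact: hom_comp homd.
    by move=> u; rewrite ffunE.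
  have := mono_e f' f'fs _ _ (ld a la) (ld b lb).
  congr (chi _ = chi _); apply/ffunP => u; by rewrite !ffunE.
have := mono_d a b la lb.
congr (chi _ = chi _); apply/ffunP => u; by rewrite !ffunE.
Qed.

Definition placements : bigraph :=
  @Bigraph ({g : {ffun B -> V} | hom g} * B)%type
    (fun b z w => (z.1 == w.1) && edge b z.2 w.2).

Definition placement_proj (z : placements) : V := val z.1 z.2.

Lemma placement_hom : hom placement_proj.
Proof.
apply/homP => b [g x] [h y] /andP[/= /eqP<-] Exy.
exact: (homP _ (valP g)).
Qed.

Lemma placements_qcfree j : qcfree j placements.
Proof.
have hom_snd : hom (snd : placements -> B).
  by apply/homP => b z w /andP[].
exact: (hom_qcfree hom_snd (@freeB j)).
Qed.

(** In a copy of [placements] provided by [iterated_amalgam] all lifts of one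
[f : A -> V] have the same colour, so [f] can be coloured by it; [i0] colours
those [f] without lifts. *)
Lemma partite_construction : hom_arrows K V B A ->
  {W : bigraph & {q : W -> V |
    [/\ hom q, qcfree l.+1 W & hom_arrows K W B A]}}.
Proof.
move=> arrV.
have [|W [q [homq freeW ramW]]] :=
  @iterated_amalgam (enum [pred f : {ffun A -> V} | hom f]) _ _ _
    placement_hom (@placements_qcfree _).
  by apply/allP => f; rewrite mem_enum.
exists W, q; split=> // chi; have [e [home qe mono_e]] := ramW chi.
have [g homg mono_g] := arrV (fun f =>
  if [pick a : {ffun A -> placements} | lifts placement_proj f a] is Some a
  then chi [ffun u => e (a u)] else i0).
have homg' : hom (finfun g).
  by rewrite (@eq_hom _ _ _ g) // => x; rewrite ffunE.
pose at_g x : placements := (exist _ (finfun g) homg', x).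
have hom_at : hom at_g by apply/homP => b x y /=; rewrite eqxx.
exists (e \o at_g); first exact: hom_comp home.
pose C (a : {ffun A -> B}) := chi [ffun u => (e \o at_g) (a u)].
move=> a b homa homb; rewrite -/(C a) -/(C b).
have chiE (c : {ffun A -> B}) : hom c -> C c =
    if [pick a : {ffun A -> placements} |
          lifts placement_proj [ffun u => g (c u)] a] is Some a
    then chi [ffun u => e (a u)] else i0.
  move=> homc.
  have lc : lifts placement_proj [ffun u => g (c u)] [ffun u => at_g (c u)].
    apply/liftsP; split; last by move=> u; rewrite !ffunE /placement_proj /= ffunE.
    rewrite (@eq_hom _ _ _ (at_g \o c)); first exact: hom_comp hom_at.
    by move=> u; rewrite ffunE.
  case: pickP => [d ld|nolift]; last by rewrite nolift in lc.
  rewrite (mono_e _ _ d _ ld lc); last first.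
    rewrite mem_enum inE (@eq_hom _ _ _ (g \o c)); first exact: hom_comp homg.
    by move=> u; rewrite ffunE.
  by congr chi; apply/ffunP => u; rewrite !ffunE.
by rewrite !chiE //; apply: mono_g.
Qed.

End PartiteConstruction.

(** * Posets and the initial chain *)

Section PosetBigraph.

Variable P : oposet.

Definition poset_bigraph : bigraph :=
  @Bigraph P (fun b => if b then @plt P else @pnon P).

Lemma poset_increasing : @increasing poset_bigraph (@pord P).
Proof.
move=> [] x y /=; last by case/and3P=> -> ->.
by move=> lt_xy; rewrite plt_pord //=; apply: contraTneq lt_xy => ->; rewrite plt_irr.
Qed.

Lemma poset_semicomplete : semicomplete poset_bigraph.
Proof.
move=> x y neq_xy; have [_ _ _ tot] := pord_linear P.
have [lt|] := boolP (plt x y || plt y x); first by exists true.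
rewrite negb_or => /andP[nlt_xy nlt_yx]; exists false.
by rewrite /= /pnon nlt_xy nlt_yx neq_xy eq_sym neq_xy !andbT.
Qed.

(** By transitivity the ends of an R-path are related by R. *)
Lemma poset_qcfree l : qcfree l poset_bigraph.
Proof.
move=> j z _ [/= Rz /and3P[_ neq_z0j]]; case/negP.
elim: j Rz neq_z0j => [|j IHj] Rz; first by rewrite eqxx.
move=> _; have [->|neq_z0j] := eqVneq (z 0) (z j); first exact: Rz.
by apply: plt_trans (Rz j _) => //; apply: IHj => // i ltij; apply/Rz/ltnW.
Qed.

Definition linear_enum : seq P := sort (@pord P) (enum P).

Lemma mem_linear_enum x : x \in linear_enum.
Proof. by rewrite mem_sort mem_enum. Qed.

Lemma linear_enum_uniq : uniq linear_enum.
Proof. by rewrite sort_uniq enum_uniq. Qed.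

Lemma linear_enum_sorted :
  sorted (fun x y => pord x y && (x != y)) linear_enum.
Proof.
have [_ _ tr tot] := pord_linear P.
have := sort_sorted tot (enum P); rewrite -/linear_enum.
have := linear_enum_uniq.
elim: linear_enum => //= x [|y s] //= IHs /andP[]; rewrite inE negb_or.
case/andP=> -> _ us /andP[-> ]; exact: IHs.
Qed.

Lemma index_linear_enum (x y : P) : pord x y -> x != y ->
  index x linear_enum < index y linear_enum.
Proof.
have [_ anti tr tot] := pord_linear P => le_xy neq_xy.
rewrite ltnNge; apply: contra neq_xy; rewrite leq_eqVlt => /predU1P[eq_i|lt_i].
  by rewrite -(nth_index x (mem_linear_enum x)) -eq_i nth_index ?mem_linear_enum.
apply/eqP/anti; rewrite le_xy /=.
by apply: (sorted_ltn_index tr (sort_sorted tot _)) lt_i; apply: mem_linear_enum.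
Qed.

End PosetBigraph.

Definition chain (n : nat) : bigraph :=
  @Bigraph 'I_n.+1 (fun _ (x y : 'I_n.+1) => x < y).

(** Listing [A] in increasing order identifies homomorphisms [A -> chain n] with
increasing sequences of length [#|A|], so a homogeneous set of size [#|B|] is the
image of the required copy of [B]. *)
Lemma chain_arrows (K : finType) (A B : oposet) :
  {n | hom_arrows K (chain n) (poset_bigraph B) (poset_bigraph A)}.
Proof.
have [n ramn] := @ramsey nat K #|A| #|B|.
exists n => chi; have tr_ltn : transitive ltn by exact: ltn_trans.
pose c s := chi [ffun u => inord (nth 0 s (index u (linear_enum A)))].
have [|i [h [sub_h sz_h hom_h]]] := ramn (iota 0 n.+1) _ c.
  by rewrite size_iota.
have sort_h : sorted ltn h.
  exact: subseq_sorted tr_ltn _ _ sub_h (iota_ltn_sorted _ _).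
have lt_h k : k < #|B| -> nth 0 h k < n.+1.
  move=> ltk; have := mem_subseq sub_h (mem_nth 0 (_ : k < size h)).
  by rewrite sz_h mem_iota; apply.
pose r (x : B) := nth 0 h (index x (linear_enum B)).
have ltr (x : B) : index x (linear_enum B) < #|B|.
  by rewrite cardE -(size_sort (@pord B)) index_mem mem_linear_enum.
have r_mono (x y : B) : pord x y -> x != y -> r x < r y.
  move=> le_xy neq_xy; apply: (sorted_ltn_nth tr_ltn 0 sort_h);
    by rewrite ?inE ?sz_h ?ltr ?index_linear_enum.
pose g (x : poset_bigraph B) : chain n := inord (r x).
have gE x : g x = r x :> nat by rewrite inordK // lt_h.
exists g.
  apply/homP => b x y /poset_increasing/andP[le_xy neq_xy] /=.
  by rewrite !gE r_mono.
suff chiE (a : {ffun A -> B}) :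
    @hom (poset_bigraph A) (poset_bigraph B) a -> chi [ffun u => g (a u)] = i.
  by move=> a b homa homb; rewrite !chiE.
move=> homa; pose s := [seq r (a u) | u <- linear_enum A].
have sort_s : sorted ltn s.
  rewrite sorted_map; apply: sub_sorted (linear_enum_sorted A) => u v.
  case/andP=> le_uv neq_uv; rewrite /= .
  have [b] := @poset_semicomplete A u v neq_uv; case/orP=> [|/poset_increasing].
    by move/(homP _ homa)/poset_increasing/andP=> [le_a neq_a]; apply: r_mono.
  have [_ anti _ _] := pord_linear A.
  case/andP=> le_vu _; case/eqP: neq_uv; apply: anti.
  by rewrite le_uv.
have <- : c s = i.
  apply: hom_h; last by rewrite size_map size_sort cardE.
  suff -> : s = filter [pred k | k \in s] h by apply: filter_subseq.
  apply: (irr_sorted_eq tr_ltn ltnn) => //.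
    exact: sorted_filter.
  move=> k; rewrite mem_filter /=; have [/mapP[u _ ->]|//] := boolP (k \in s).
  by rewrite mem_nth ?sz_h.
congr chi; apply/ffunP => u; rewrite !ffunE.
rewrite (nth_map u) ?index_mem ?mem_linear_enum // nth_index //.
exact: mem_linear_enum.
Qed.

(** * From ordered graphs to RN graphs *)

Record ordered_bigraph := OrderedBigraph {
  obg :> bigraph;
  obg_le : rel obg;
  obg_linear : linear_order obg_le;
  obg_increasing : increasing obg_le
}.

Section Pullback.

Variables (V : ordered_bigraph) (W : bigraph) (q : W -> V).
Hypothesis homq : hom q.

(** Fibres of [q] are ordered arbitrarily; edges never lie inside a fibre. *)
Definition pullback_le : rel W := fun x y =>
  if q x == q y then enum_rank x <= enum_rank y else obg_le (q x) (q y).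

Lemma pullback_linear : linear_order pullback_le.
Proof.
have [rfl anti tr tot] := obg_linear V; rewrite /pullback_le; split.
- by move=> x; rewrite eqxx.
- move=> x y; rewrite (eq_sym (q y)); case: eqVneq => [_|neq_q].
    by rewrite -eqn_leq => /eqP/val_inj/enum_rank_inj.
  by move/anti=> eq_q; rewrite eq_q eqxx in neq_q.
- move=> y x z.
  have [->|neq_xy] := eqVneq (q x) (q y).
    by case: eqVneq => // _; apply: leq_trans.
  have [<-|neq_yz] := eqVneq (q y) (q z); first by rewrite (negPf neq_xy).
  move=> le_xy le_yz; have [eq_xz|_] := eqVneq; last exact: tr le_xy le_yz.
  by case/eqP: neq_xy; apply: anti; rewrite le_xy eq_xz.
- move=> x y; rewrite (eq_sym (q y)); case: eqVneq => _; last exact: tot.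
  exact: leq_total.
Qed.

Lemma pullback_increasing : increasing pullback_le.
Proof.
move=> b x y /(homP _ homq)/(@obg_increasing V)/andP[le_q neq_q].
rewrite /pullback_le (negPf neq_q) le_q; apply: contra neq_q => /eqP->.
exact: eqxx.
Qed.

Definition pullback : ordered_bigraph :=
  OrderedBigraph pullback_linear pullback_increasing.

Lemma pullback_monotone (x y : W) : pullback_le x y -> obg_le (q x) (q y).
Proof.
have [rfl _ _ _] := obg_linear V.
by rewrite /pullback_le; case: eqP => // -> _; apply: rfl.
Qed.

End Pullback.

Section ToRNgraph.

Variables (G : ordered_bigraph) (freeG : qcfree 2 G).

Let orG : oriented G := increasing_oriented (obg_linear G) (@obg_increasing G).

Fact edge_acyclic b : acyclic (@edge G b).
Proof.
apply: irr_subrel_acyclic (obg_linear G) _ _ => [x|x y].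
  exact/negbTE/oriented_irr.
by case/obg_increasing/andP.
Qed.

Fact edge_disjoint (x y : G) : ~~ (edge true x y && edge false x y).
Proof. by apply/negP => /andP[/(qcfree2_disjoint freeG)/negP]. Qed.

Fact edge_le b : subrel (@edge G b) (@obg_le G).
Proof. by move=> x y /obg_increasing/andP[]. Qed.

Definition to_RNgraph : RNgraph :=
  MkRNgraph (obg_linear G) (@edge_acyclic true) (@edge_acyclic false)
            edge_disjoint (@edge_le true) (@edge_le false).

Lemma qcfree_l_RN l : qcfree l G -> l_RN l to_RNgraph.
Proof.
move=> freel j /andP[_ lejl] [|x s] [/= szs]; first by [].
case=> /(pathP x) Rs Ns.
apply: (freel (size s) (nth x (x :: s))); first by rewrite szs.
by split=> //; rewrite -last_nth.
Qed.

Lemma hom_embedding (P : oposet) (f : P -> G) :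
  @hom (poset_bigraph P) G f -> @embedding P to_RNgraph f.
Proof.
move=> homf; have comP := @poset_semicomplete P.
have injf : injective f by apply: (hom_inj comP orG homf).
have [rflG antiG _ _] := obg_linear G; have [rflP antiP _ totP] := pord_linear P.
have edgeE b x y : @edge (poset_bigraph P) b x y = @edge G b (f x) (f y).
  apply/idP/idP; first exact: (homP _ homf).
  exact: (hom_reflect comP orG freeG homf).
have le_f x y : pord x y -> obg_le (f x) (f y).
  have [->|neq_xy le_xy] := eqVneq x y; first by rewrite rflG.
  have [b /orP[]] := comP x y neq_xy.
    by rewrite edgeE => /edge_le.
  case/poset_increasing/andP=> le_yx _; case/eqP: neq_xy; apply: antiP.
  by rewrite le_xy.
split=> // x y; split; [exact: (edgeE true)|exact: (edgeE false)|].
apply/idP/idP => [/le_f//|/= le_fxy].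
case/orP: (totP x y) => // /[dup] le_yx /le_f le_fyx.
have /injf eq_xy : f x = f y by apply: antiG; rewrite le_fxy.
by rewrite eq_xy rflP.
Qed.

(** A copy of [A] inside the copy [g @: B] of [B] is [g \o a] for some
homomorphism [a : A -> B], because [g] is an embedding. *)
Lemma hom_arrows_arrows (A B : oposet) :
    hom_arrows 'I_2 G (poset_bigraph B) (poset_bigraph A) ->
  arrows 2 to_RNgraph B A.
Proof.
move=> arrG chi.
have [g homg mono_g] := arrG (fun a => chi [set a u | u : A]).
have [_ embg] := hom_embedding homg.
set S : {set to_RNgraph} := [set g x | x : B].
exists S; first by exists g => //; apply: hom_embedding.
suff copyE (T : {set induced S}) : is_copy A T ->
    exists2 a : {ffun A -> B}, @hom (poset_bigraph A) (poset_bigraph B) a &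
      [set val x | x in T] = [set [ffun u => g (a u)] u | u : A].
  by move=> T1 T2 /copyE[a homa ->] /copyE[b homb ->]; apply: mono_g.
case=> f [_ embf] ->.
have imf u : val (f u) \in codom g.
  by have /imsetP[x _ ->] := valP (f u); apply: codom_f.
exists [ffun u => iinv (imf u)].
  apply/homP => -[] u v; rewrite !ffunE; have [Rf Nf _] := embf u v;
    have [/= Rg Ng _] := embg (iinv (imf u)) (iinv (imf v)).
    by rewrite /= Rg !f_iinv; rewrite /= in Rf; rewrite Rf.
  by rewrite /= Ng !f_iinv; rewrite /= in Nf; rewrite Nf.
rewrite -imset_comp; apply: eq_imset => u.
by rewrite /= !ffunE f_iinv.
Qed.

End ToRNgraph.

(** * The sequence *)

Section Tower.

Variables A B : oposet.

(** At [l = 1] the two relations may still overlap, as in the chain; from [l = 2]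
on a stage is an RN graph. *)
Definition stage (l : nat) : Type :=
  {G : ordered_bigraph |
     qcfree l G /\ hom_arrows 'I_2 G (poset_bigraph B) (poset_bigraph A)}.

Lemma next_stage l (V : stage l.+1) :
  {W : stage l.+2 & {q : sval W -> sval V |
     hom q /\ forall x y, obg_le x y -> obg_le (q x) (q y)}}.
Proof.
case: V => V /= [freeV arrV].
have [W [q [homq freeW arrW]]] :=
  partite_construction ord0 (@poset_semicomplete A) (@poset_qcfree A 3)
    (@poset_qcfree B) (obg_linear V) (@obg_increasing V) (ltn0Sn l) freeV arrV.
exists (exist _ (pullback homq) (conj freeW arrW)), q; split=> //.
exact: pullback_monotone.
Qed.

Lemma first_stage : stage 1.
Proof.
have [n arrn] := chain_arrows 'I_2 A B.
have lin : @linear_order (chain n) (fun x y : 'I_n.+1 => x <= y).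
  split.
  - by move=> x; apply: leqnn.
  - by move=> x y; rewrite -eqn_leq => /eqP/val_inj.
  - by move=> y x z; apply: leq_trans.
  - by move=> x y; apply: leq_total.
have inc : @increasing (chain n) (fun x y : 'I_n.+1 => x <= y).
  by move=> b x y; rewrite /= ltn_neqAle andbC.
exists (OrderedBigraph lin inc); split=> //= -[|//] z _ [_].
by rewrite /= ltnn.
Qed.

Fixpoint tower (k : nat) : stage k.+1 :=
  if k is m.+1 then projT1 (next_stage (tower m)) else first_stage.

Definition tower_proj (k : nat) : sval (tower k.+1) -> sval (tower k) :=
  sval (projT2 (next_stage (tower k))).

Lemma tower_qcfree2 k : qcfree 2 (sval (tower k.+1)).
Proof. exact: (qcfree_le _ (proj1 (svalP (tower k.+1)))). Qed.

(** The values at [0] and [1] repeat the graph at [2]. *)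
Definition ramsey_RNgraph (l : nat) : RNgraph :=
  to_RNgraph (@tower_qcfree2 l.-2).

Definition ramsey_proj (l : nat) :
    2 <= l -> ramsey_RNgraph l.+1 -> ramsey_RNgraph l :=
  match l with
  | k.+2 => fun _ => @tower_proj k.+1
  | _ => fun _ => id
  end.

Lemma ramsey_proj_hom l (l_ge2 : 2 <= l) : homomorphism (ramsey_proj l_ge2).
Proof.
case: l l_ge2 => [|[|k]] // l_ge2 x y.
have [homq leq] := svalP (projT2 (next_stage (tower k.+1))).
split; [exact: (homP _ homq true)|exact: (homP _ homq false)|exact: leq].
Qed.

End Tower.

Theorem theorem1p8 (A B : oposet) :
  exists (C : nat -> RNgraph) (h : forall l, 2 <= l -> C l.+1 -> C l),
    (forall (l : nat) (l_ge2 : 2 <= l),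
       [/\ arrows 2 (C l) B A,
           l_RN l (C l)
         & homomorphism (h l l_ge2)]) /\
    (forall k : nat, homomorphism (hstar h (k := k))).
Proof.
exists (ramsey_RNgraph A B), (@ramsey_proj A B); split=> [l l_ge2|].
  case: l l_ge2 => [|[|k]] // l_ge2; split; last exact: ramsey_proj_hom.
    by apply: hom_arrows_arrows; apply: (svalP (tower A B k.+1)).2.
  by apply: qcfree_l_RN; apply: (svalP (tower A B k.+1)).1.
elim=> [|k IHk] x y; first by [].
have [R1 N1 O1] := ramsey_proj_hom (isT : 2 <= k.+2) x y.
have [R2 N2 O2] := IHk (ramsey_proj (isT : 2 <= k.+2) x)
                       (ramsey_proj (isT : 2 <= k.+2) y).
by split=> [/R1/R2|/N1/N2|/O1/O2].
Qed.
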